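(* Let $k\ge 1$ be an integer, let $0<K_1,K_2\le \frac1k$ be constants, and let $0<\alpha_1\le\beta_1$ and $0<\alpha_2\le\beta_2$ be constants. Then there is a constant $L>0$, depending only on $k,K_1,K_2,\alpha_1,\beta_1,\alpha_2,\beta_2$ (in particular not on $n$ and $m$), such that the following holds for all $n,m$. Let $C=(c_{ij})$ be a non-decomposable $n\times m$ contingency table with row set $Row$ and column set $Col$, with $\sum_{i=1}^n\sum_{j=1}^m c_{ij}=1$, and with no dominant rows and columns, i.e. $\frac{\alpha_1}{n}\le d_{row,i}\le\frac{\beta_1}{n}$ for $i=1,\dots,n$ and $\frac{\alpha_2}{m}\le d_{col,j}\le\frac{\beta_2}{m}$ for $j=1,\dots,m$. Let $\varepsilon\ge 0$ and suppose that the singular values of $C_{corr}$ satisfy $$1=s_1>s_2\ge\dots\ge s_k>\varepsilon\ge s_i,\qquad i\ge k+1 .$$ Let $X$ and $Y$ be the matrices of the optimal $k$-dimensional row and column representatives of $C$, and let $(R_1,\dots,R_k)$ be a partition of $Row$ and $(C_1,\dots,C_k)$ a partition of $Col$ minimizing the weighted $k$-variances, i.e. attaining $S_k^2(X)$ and $S_k^2(Y)$, respectively. Suppose that $|R_i|\ge K_1 n$ and $|C_i|\ge K_2 m$ for $i=1,\dots,k$. Then for all $i,j=1,\dots,k$ the row--column cluster pair $R_i,C_j$ is $\gamma$-volume regular with $$\gamma=L\left(\sqrt{2k}\,\bigl(S_k(X)+S_k(Y)\bigr)+\varepsilon\right).$$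
   Context: A contingency table is an $n\times m$ real matrix $C=(c_{ij})$ with $c_{ij}\ge 0$, with row set $Row=\{1,\dots,n\}$ and column set $Col=\{1,\dots,m\}$, and no identically zero row or column. The row sums are $d_{row,i}=\sum_{j=1}^m c_{ij}$, the column sums are $d_{col,j}=\sum_{i=1}^n c_{ij}$, and $D_{row}$, $D_{col}$ are the diagonal matrices with the row sums and column sums, respectively, in the main diagonal. The correspondence matrix is $C_{corr}=D_{row}^{-1/2}CD_{col}^{-1/2}$, with singular values $s_1\ge s_2\ge\cdots$ and singular value decomposition $C_{corr}=\sum_{i=1}^r s_i v_iu_i^T$, where $r$ is its rank and $(v_i)\subset\mathbb{R}^n$, $(u_i)\subset\mathbb{R}^m$ are orthonormal systems. $C$ is called non-decomposable if $CC^T$ is irreducible. Optimal representatives: $X=(x_1,\dots,x_k)$ is the $n\times k$ matrix with columns $x_i=D_{row}^{-1/2}v_i$, and $Y=(y_1,\dots,y_k)$ is the $m\times k$ matrix with columns $y_i=D_{col}^{-1/2}u_i$ ($i=1,\dots,k$). The optimal $k$-dimensional row representatives $r_1,\dots,r_n\in\mathbb{R}^k$ are the (transposed) rows of $X$, and the optimal $k$-dimensional column representatives $c_1,\dots,c_m\in\mathbb{R}^k$ are the (transposed) rows of $Y$. Volumes and cuts: for $R\subset Row$ and $D\subset Col$, $\mathrm{Vol}(R)=\sum_{i\in R}d_{row,i}$, $\mathrm{Vol}(D)=\sum_{j\in D}d_{col,j}$ and $c(R,D)=\sum_{i\in R}\sum_{j\in D}c_{ij}$. Weighted $k$-variances: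 $$S_k^2(X)=\min_{(R_1,\dots,R_k)}\sum_{a=1}^k\sum_{j\in R_a}d_{row,j}\|r_j-\bar r_a\|^2,\qquad \bar r_a=\frac1{\mathrm{Vol}(R_a)}\sum_{j\in R_a}d_{row,j}r_j,$$ $$S_k^2(Y)=\min_{(C_1,\dots,C_k)}\sum_{a=1}^k\sum_{j\in C_a}d_{col,j}\|c_j-\bar c_a\|^2,\qquad \bar c_a=\frac1{\mathrm{Vol}(C_a)}\sum_{j\in C_a}d_{col,j}c_j,$$ where the minima are over partitions of $Row$, respectively $Col$, into $k$ disjoint nonempty subsets; $S_k(X)$ and $S_k(Y)$ denote the nonnegative square roots. Volume regularity: for a contingency table of total sum 1, the row--column cluster pair $R\subset Row$, $D\subset Col$ is $\gamma$-volume regular if for all $A\subset R$ and $B\subset D$ $$\left|c(A,B)-\rho(R,D)\,\mathrm{Vol}(A)\,\mathrm{Vol}(B)\right|\le\gamma\sqrt{\mathrm{Vol}(R)\,\mathrm{Vol}(D)},\qquad \rho(R,D)=\frac{c(R,D)}{\mathrm{Vol}(R)\,\mathrm{Vol}(D)} .$$ *)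

(* Defs.v *)
From mathcomp Require Import classical_sets reals.
From mathcomp Require Import all_boot all_order all_fingroup all_algebra.

Set Implicit Arguments.
Unset Strict Implicit.
Unset Printing Implicit Defensive.

Import Order.TTheory GRing.Theory Num.Theory.
Local Open Scope ring_scope.

(* [classical_sets] is imported first so that [set0], [setT], ... denote the   *)
(* finite-set versions.  Indices are 0-based: the i-th singular value,         *)
(* singular vector or cluster of the usual 1-based numbering has index i - 1.  *)

Section Definitions.
Variable R : realType.

Definition contingency_table n m (C : 'M[R]_(n, m)) : Prop :=
  [/\ forall i j, 0 <= C i j,
      forall i, exists j, C i j != 0
    & forall j, exists i, C i j != 0].

Definition drow n m (C : 'M[R]_(n, m)) (i : 'I_n) : R := \sum_(j < m) C i j.
Definition dcol n m (C : 'M[R]_(n, m)) (j : 'I_m) : R := \sum_(i < n) C i j.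

(* diag(d)^(-1/2) *)
Definition diag_invsqrt n (d : 'I_n -> R) : 'M[R]_n :=
  diag_mx (\row_i (Num.sqrt (d i))^-1).

Definition corr_mx n m (C : 'M[R]_(n, m)) : 'M[R]_(n, m) :=
  diag_invsqrt (drow C) *m C *m diag_invsqrt (dcol C).

(* Some simultaneous permutation of the rows and columns of [A] yields a block *)
(* upper triangular matrix with two nonempty diagonal blocks, of sizes p and   *)
(* n - p.                                                                      *)
Definition reducible_mx n (A : 'M[R]_n) : Prop :=
  exists (s : 'S_n) (p : nat), [/\ (0 < p)%N, (p < n)%N
    & forall i j : 'I_n, (p <= i)%N -> (j < p)%N ->
        row_perm s (col_perm s A) i j = 0].

Definition irreducible_mx n (A : 'M[R]_n) : Prop := ~ reducible_mx A.

Definition non_decomposable n m (C : 'M[R]_(n, m)) : Prop :=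
  irreducible_mx (C *m C^T).

Definition orthonormal_upto n (r : nat) (v : nat -> 'cV[R]_n) : Prop :=
  forall i j, (i < r)%N -> (j < r)%N -> (v i)^T *m v j = (i == j)%:R%:M.

(* The singular values are continued by 0 beyond the rank r of [A]; the        *)
(* singular vectors of index >= r are irrelevant.                              *)
Definition is_svd n m (A : 'M[R]_(n, m)) (s : nat -> R)
    (v : nat -> 'cV[R]_n) (u : nat -> 'cV[R]_m) : Prop :=
  let r := \rank A in
  [/\ (forall i, (i < r)%N -> 0 < s i) /\ (forall i, (r <= i)%N -> s i = 0),
      forall i j, (i <= j)%N -> s j <= s i,
      orthonormal_upto r v,
      orthonormal_upto r u
    & A = \sum_(i < r) s i *: (v i *m (u i)^T)].

(* The n x k matrix with columns diag(d)^(-1/2) v_i; the representative of the *)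
(* index j is its j-th row.                                                    *)
Definition representatives n (k : nat) (d : 'I_n -> R) (v : nat -> 'cV[R]_n) :
    'M[R]_(n, k) :=
  \matrix_(j < n, i < k) (diag_invsqrt d *m v i) j 0.

Definition vol n (d : 'I_n -> R) (A : {set 'I_n}) : R := \sum_(i in A) d i.

Definition cut n m (C : 'M[R]_(n, m)) (A : {set 'I_n}) (B : {set 'I_m}) : R :=
  \sum_(i in A) \sum_(j in B) C i j.

(* Euclidean norm; the library's norm on matrices is the sup norm. *)
Definition sqnorm k (x : 'rV[R]_k) : R := \sum_(i < k) x 0 i ^+ 2.

Definition kpartition n k (P : 'I_k -> {set 'I_n}) : Prop :=
  [/\ forall a, P a != set0,
      forall a b, a != b -> [disjoint P a & P b]
    & \bigcup_(a < k) P a = [set: 'I_n]].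

Definition wmean n k (d : 'I_n -> R) (X : 'M[R]_(n, k)) (A : {set 'I_n}) :
    'rV[R]_k :=
  (vol d A)^-1 *: \sum_(j in A) d j *: row j X.

Definition partition_cost n k (d : 'I_n -> R) (X : 'M[R]_(n, k))
    (P : 'I_k -> {set 'I_n}) : R :=
  \sum_(a < k) \sum_(j in P a) d j * sqnorm (row j X - wmean d X (P a)).

(* S_k^2(X); there are finitely many partitions, so the infimum is a minimum   *)
(* as soon as there is at least one.                                           *)
Definition kvariance n k (d : 'I_n -> R) (X : 'M[R]_(n, k)) : R :=
  inf [set partition_cost d X P | P in @kpartition n k]%classic.

Definition optimal_partition n k (d : 'I_n -> R) (X : 'M[R]_(n, k))
    (P : 'I_k -> {set 'I_n}) : Prop :=
  kpartition P /\ partition_cost d X P = kvariance d X.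

Definition density n m (C : 'M[R]_(n, m)) (A : {set 'I_n}) (B : {set 'I_m}) :
    R :=
  cut C A B / (vol (drow C) A * vol (dcol C) B).

Definition volume_regular n m (C : 'M[R]_(n, m)) (gamma : R)
    (P : {set 'I_n}) (Q : {set 'I_m}) : Prop :=
  forall (A : {set 'I_n}) (B : {set 'I_m}), A \subset P -> B \subset Q ->
    `|cut C A B - density C P Q * vol (drow C) A * vol (dcol C) B|
      <= gamma * Num.sqrt (vol (drow C) P * vol (dcol C) Q).

End Definitions.

(* Main.v *)
(* Write w_A = D_row^(1/2) 1_A and likewise w_B, so that c(A,B) = w_A^T C_corr  *)
(* w_B.  With t_A = Vol(A)/Vol(P) and t_B = Vol(B)/Vol(Q), the discrepancy      *)
(* c(A,B) - rho(P,Q) Vol(A) Vol(B) equals                                       *)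
(*   (w_A - t_A w_P)^T C_corr w_B + t_A w_P^T C_corr (w_B - t_B w_Q).           *)
(* Expand both terms in the singular vectors.  By Bessel and Cauchy-Schwarz the *)
(* singular values of index >= k contribute at most eps sqrt(Vol(P) Vol(Q)) to  *)
(* each.  Since D_row^(1/2) (w_A - t_A w_P) is supported in P and has zero sum, *)
(* its inner products with the columns of X are unchanged when the weighted     *)
(* mean over P is subtracted from the representatives; hence the first k        *)
(* coordinates of w_A - t_A w_P have norm at most sqrt(Vol(P)) S_k(X).          *)
(* Altogether gamma = S_k(X) + S_k(Y) + 2 eps works, so L = 2 does.             *)

Require Import Defs.
From mathcomp Require Import classical_sets reals.
From mathcomp Require Import all_boot all_order all_fingroup all_algebra.
From mathcomp Require Import ring lra.

Set Implicit Arguments.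
Unset Strict Implicit.
Unset Printing Implicit Defensive.

Import Order.TTheory GRing.Theory Num.Theory.
Local Open Scope ring_scope.

(** For [A] inside [P], the vector [t_A w_P] is the orthogonal projection of [w_A] onto [w_P], and
    [deviation] is the residual. The density term of the discrepancy is the bilinear form of
    [corr_mx C] at the projections of [w_A] and [w_B], so each term of the discrepancy has a
    residual as one argument. [svd_bilinear_le] cuts such a form at index k: the tail costs [eps]
    times the two norms, the head the product of the norms of the first k coordinates.
    [deviation_representatives_le] bounds the head of a residual by the cost of its cluster, hence
    by the k-variance; [bessel] bounds the head of the other argument by its volume. *)

Section FiniteSums.
Variable R : realType.

(** Cauchy-Schwarz: after multiplication by the sum of the squares of [b], the gap becomes a sum of
    squares. *)
Lemma sqr_sum_mul_le (I : finType) (P : pred I) (a b : I -> R) :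
  (\sum_(i | P i) a i * b i) ^+ 2
    <= (\sum_(i | P i) a i ^+ 2) * (\sum_(i | P i) b i ^+ 2).
Proof.
set S := \sum_(i | P i) a i * b i.
set SA := \sum_(i | P i) a i ^+ 2; set SB := \sum_(i | P i) b i ^+ 2.
have SB_ge0 : 0 <= SB by apply: sumr_ge0 => i _; exact: sqr_ge0.
have H : 0 <= SB * (SA * SB - S ^+ 2).
  have -> : SB * (SA * SB - S ^+ 2)
          = \sum_(i | P i) (SB * a i - S * b i) ^+ 2.
    transitivity (SB ^+ 2 * SA - 2 * SB * S * S + S ^+ 2 * SB); first by ring.
    rewrite [in RHS](eq_bigr (fun i => (SB ^+ 2 * a i ^+ 2
      - 2 * SB * S * (a i * b i)) + S ^+ 2 * b i ^+ 2)); last first.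
      by move=> i _; ring.
    by rewrite big_split /= sumrB -!mulr_sumr.
  by apply: sumr_ge0 => i _; exact: sqr_ge0.
(* The factor [SB] cancels only if it is nonzero; otherwise every [b i] vanishes and both sides are
   0. *)
have [SB0|SB_neq0] := eqVneq SB 0; last first.
  by move: H; rewrite pmulr_rge0 ?subr_ge0 // lt_def SB_neq0.
have b0 i : P i -> b i = 0.
  move=> Pi; apply/eqP; rewrite -sqrf_eq0; apply/eqP.
  exact: (psumr_eq0P (fun j _ => sqr_ge0 (b j)) SB0).
rewrite /S big1 ?expr0n /= ?SB0 ?mulr0 // => i Pi.
by rewrite b0 ?mulr0.
Qed.

(** The weights will be singular values, with [c] = 1 on the head of the decomposition and [c] =
    [eps] on its tail. *)
Lemma norm_weighted_sum_le (I : finType) (P : pred I) (c : R) (w a b : I -> R) :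
  0 <= c -> (forall i, P i -> 0 <= w i <= c) ->
  `|\sum_(i | P i) w i * (a i * b i)|
    <= c * (Num.sqrt (\sum_(i | P i) a i ^+ 2)
            * Num.sqrt (\sum_(i | P i) b i ^+ 2)).
Proof.
move=> c0 hw; have ss0 (f : I -> R) : 0 <= \sum_(i | P i) f i ^+ 2.
  by apply: sumr_ge0 => i _; exact: sqr_ge0.
apply: (le_trans (ler_norm_sum _ _ _)).
apply: (@le_trans _ _ (c * \sum_(i | P i) `|a i| * `|b i|)).
  rewrite mulr_sumr; apply: ler_sum => i Pi; have /andP[w0 wc] := hw i Pi.
  by rewrite !normrM (ger0_norm w0) ler_wpM2r // mulr_ge0.
apply: ler_wpM2l => //; rewrite -sqrtrM // -[leLHS]ger0_norm -?sqrtr_sqr; last first.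
  by apply: sumr_ge0 => i _; rewrite mulr_ge0.
apply: ler_wsqrtr; apply: (le_trans (sqr_sum_mul_le _ _ _)).
have normK (f : I -> R) :
    \sum_(i | P i) `|f i| ^+ 2 = \sum_(i | P i) f i ^+ 2.
  by apply: eq_bigr => i _; rewrite real_normK ?num_real.
by rewrite !normK.
Qed.

End FiniteSums.

(** * Bessel's inequality and bilinear forms in singular coordinates *)

Section Singular.
Variable R : realType.

Definition dotv n (x y : 'cV[R]_n) : R := (x^T *m y) 0 0.

Lemma dotvE n (x y : 'cV[R]_n) : dotv x y = \sum_j x j 0 * y j 0.
Proof. by rewrite /dotv mxE; apply: eq_bigr => j _; rewrite mxE. Qed.

Lemma dotvC n (x y : 'cV[R]_n) : dotv x y = dotv y x.
Proof. by rewrite !dotvE; apply: eq_bigr => j _; rewrite mulrC. Qed.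

Lemma dotvBl n (x y z : 'cV[R]_n) : dotv (x - y) z = dotv x z - dotv y z.
Proof. by rewrite !dotvE -sumrB; apply: eq_bigr => j _; rewrite !mxE mulrBl. Qed.

Lemma dotvZl n (c : R) (x y : 'cV[R]_n) : dotv (c *: x) y = c * dotv x y.
Proof. by rewrite !dotvE mulr_sumr; apply: eq_bigr => j _; rewrite mxE mulrA. Qed.

Lemma dotvBr n (x y z : 'cV[R]_n) : dotv x (y - z) = dotv x y - dotv x z.
Proof. by rewrite dotvC dotvBl !(dotvC x). Qed.

Lemma dotvZr n (c : R) (x y : 'cV[R]_n) : dotv x (c *: y) = c * dotv x y.
Proof. by rewrite dotvC dotvZl dotvC. Qed.

Lemma dotv_ge0 n (x : 'cV[R]_n) : 0 <= dotv x x.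
Proof. by rewrite dotvE sumr_ge0 // => j _; rewrite -expr2 sqr_ge0. Qed.

Lemma bessel n r (v : nat -> 'cV[R]_n) (x : 'cV[R]_n) :
  orthonormal_upto r v -> \sum_(i < r) dotv x (v i) ^+ 2 <= dotv x x.
Proof.
move=> ov; pose V := \matrix_(j < n, i < r) v i j 0.
have VV : V^T *m V = 1%:M.
  apply/matrixP => i j; have := ov i j (ltn_ord i) (ltn_ord j).
  move/matrixP/(_ 0 0); rewrite !mxE /= ?mulr1n => <-.
  by apply: eq_bigr => l _; rewrite !mxE.
pose c := V^T *m x.
have cE : \sum_(i < r) dotv x (v i) ^+ 2 = dotv c c.
  rewrite dotvE; apply: eq_bigr => i _; rewrite expr2.
  suff -> : c i 0 = dotv x (v i) by [].
  by rewrite dotvC dotvE /c mxE; apply: eq_bigr => j _; rewrite !mxE.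
(* [V *m c] is the projection of [x] onto the span of the [v i]; Pythagoras turns the nonnegative
   squared residual into the inequality. *)
have := dotv_ge0 (x - V *m c).
suff -> : dotv (x - V *m c) (x - V *m c) = dotv x x - dotv c c.
  by rewrite cE subr_ge0.
have E1 : x^T *m (V *m c) = c^T *m c by rewrite mulmxA /c trmx_mul trmxK.
have E2 : (V *m c)^T *m x = c^T *m c by rewrite trmx_mul -mulmxA.
have E3 : (V *m c)^T *m (V *m c) = c^T *m c.
  by rewrite trmx_mul -mulmxA [V^T *m _]mulmxA VV mul1mx.
rewrite /dotv [(x - _)^T]linearB /= mulmxBl !mulmxBr E1 E2 E3 subrr subr0.
by rewrite !mxE.
Qed.

Lemma orthonormal_uptoW n k r (v : nat -> 'cV[R]_n) :
  (k <= r)%N -> orthonormal_upto r v -> orthonormal_upto k v.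
Proof. by move=> kr ov i j ik jk; apply: ov; exact: leq_trans kr. Qed.

Lemma svd_bilinear n m (A : 'M[R]_(n, m)) s v u (x : 'cV[R]_n) (y : 'cV[R]_m) :
  is_svd A s v u ->
  dotv x (A *m y) = \sum_(i < \rank A) s i * (dotv x (v i) * dotv y (u i)).
Proof.
case=> _ _ _ _ AE; rewrite /dotv mulmxA [in LHS]AE mulmx_sumr mulmx_suml summxE.
apply: eq_bigr => i _; rewrite -scalemxAr -scalemxAl mxE; congr (_ * _).
rewrite mulmxA -[(_ *m y)]mulmxA mxE big_ord1; congr (_ * _).
by rewrite -/(dotv y _) dotvC.
Qed.

Lemma svd_bilinear_le n m (A : 'M[R]_(n, m)) s v u k (eps : R)
    (x : 'cV[R]_n) (y : 'cV[R]_m) :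
  is_svd A s v u -> s 0%N <= 1 -> (k <= \rank A)%N -> 0 <= eps ->
  (forall i, (k <= i)%N -> s i <= eps) ->
  `|dotv x (A *m y)|
    <= Num.sqrt (\sum_(i < k) dotv x (v i) ^+ 2)
       * Num.sqrt (\sum_(i < k) dotv y (u i) ^+ 2)
       + eps * (Num.sqrt (dotv x x) * Num.sqrt (dotv y y)).
Proof.
move=> svdA s0 kr eps0 tail; rewrite (svd_bilinear _ _ svdA).
have [[s_gt0 _] s_mono ov ou _] := svdA.
pose xv (i : 'I_(\rank A)) := dotv x (v i).
pose yu (i : 'I_(\rank A)) := dotv y (u i).
rewrite (bigID (fun i : 'I_(\rank A) => (i < k)%N)) /=.
apply: (le_trans (ler_normD _ _)); apply: lerD.
  rewrite (big_ord_widen _ (fun i => dotv x (v i) ^+ 2) kr).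
  rewrite (big_ord_widen _ (fun i => dotv y (u i) ^+ 2) kr).
  (* On the head the singular values lie in [0, 1], since they decrease from [s 0]. *)
  rewrite -[leRHS]mul1r.
  apply: norm_weighted_sum_le xv yu _ _ => // i _.
  by rewrite ltW ?s_gt0 ?(le_trans _ s0) ?s_mono.
apply: (le_trans (norm_weighted_sum_le xv yu eps0 _)).
  by move=> i; rewrite -leqNgt => ki; rewrite ltW ?s_gt0 ?tail.
(* The tail coordinates are part of the Bessel sum over all indices below the rank. *)
have tail_le p (w : nat -> 'cV[R]_p) (z : 'cV[R]_p) :
    orthonormal_upto (\rank A) w ->
    \sum_(i < \rank A | ~~ (i < k)%N) dotv z (w i) ^+ 2 <= dotv z z.
  move=> ow; apply: le_trans (bessel z ow).
  rewrite [leRHS](bigID (fun i : 'I_(\rank A) => (i < k)%N)) /= lerDr.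
  by apply: sumr_ge0 => i _; exact: sqr_ge0.
by rewrite ler_wpM2l // ler_pM ?sqrtr_ge0 ?ler_wsqrtr ?tail_le.
Qed.

End Singular.

(** * Weighted indicators, their residuals and the cost of a cluster *)

Section Clusters.
Variable R : realType.

Definition sqrt_indicator n (d : 'I_n -> R) (A : {set 'I_n}) : 'cV[R]_n :=
  \col_j ((j \in A)%:R * Num.sqrt (d j)).

(** For [A] inside [P], the component of [w_A] orthogonal to [w_P]. *)
Definition deviation n (d : 'I_n -> R) (P A : {set 'I_n}) : 'cV[R]_n :=
  sqrt_indicator d A - (vol d A / vol d P) *: sqrt_indicator d P.

Lemma vol_ge0 n (d : 'I_n -> R) (A : {set 'I_n}) :
  (forall i, 0 < d i) -> 0 <= vol d A.
Proof. by move=> d0; apply: sumr_ge0 => i _; exact: ltW. Qed.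

Lemma vol_gt0 n (d : 'I_n -> R) (A : {set 'I_n}) :
  (forall i, 0 < d i) -> A != finset.set0 -> 0 < vol d A.
Proof.
move=> d0 /set0Pn [i iA]; rewrite /vol (bigD1 i) //= ltr_pwDl //.
by apply: sumr_ge0 => j _; exact: ltW.
Qed.

Lemma vol_subset n (d : 'I_n -> R) (A B : {set 'I_n}) :
  (forall i, 0 < d i) -> A \subset B -> vol d A <= vol d B.
Proof.
move=> d0 AB; rewrite /vol [leRHS](finset.big_setID A) /= (finset.setIidPr AB).
by rewrite lerDl; apply: sumr_ge0 => i _; exact: ltW.
Qed.

Lemma dotv_sqrt_indicator n (d : 'I_n -> R) (A B : {set 'I_n}) :
  (forall i, 0 < d i) -> A \subset B ->
  dotv (sqrt_indicator d A) (sqrt_indicator d B) = vol d A.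
Proof.
move=> d0 AB; rewrite dotvE /vol [RHS]big_mkcond; apply: eq_bigr => j _ /=.
rewrite !mxE; case: ifPn => jA; last by rewrite !mul0r.
by rewrite (fintype.subsetP AB _ jA) !mul1r -expr2 sqr_sqrtr // ltW.
Qed.

Lemma dotv_deviation_le n (d : 'I_n -> R) (P A : {set 'I_n}) :
  (forall i, 0 < d i) -> P != finset.set0 -> A \subset P ->
  dotv (deviation d P A) (deviation d P A) <= vol d P.
Proof.
move=> d0 P0 AP; have vP := vol_gt0 d0 P0.
have -> : dotv (deviation d P A) (deviation d P A)
        = vol d A - vol d A ^+ 2 / vol d P.
  rewrite dotvBl !dotvBr !dotvZl !dotvZr (dotvC (sqrt_indicator d P)).
  by rewrite !dotv_sqrt_indicator //; field; rewrite gt_eqF.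
apply: le_trans (vol_subset d0 AP).
by rewrite gerBl divr_ge0 ?sqr_ge0 ?vol_ge0.
Qed.

(** Orthogonality to [w_P] lets any fixed vector [r] be subtracted from the representatives without
    changing the coordinates of the residual. The weighted mean of the cluster is the choice that
    matters later. *)
Lemma deviation_representatives_le n k (d : 'I_n -> R) (v : nat -> 'cV[R]_n)
    (P A : {set 'I_n}) (r : 'rV[R]_k) :
  (forall i, 0 < d i) -> P != finset.set0 -> A \subset P ->
  \sum_(i < k) dotv (deviation d P A) (v i) ^+ 2
    <= vol d P * \sum_(j in P) d j * sqnorm (row j (representatives k d v) - r).
Proof.
move=> d0 P0 AP; set X := representatives k d v.
have vP := vol_gt0 d0 P0.
have sq0 j : Num.sqrt (d j) != 0 by rewrite gt_eqF // sqrtr_gt0.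
have XE j i : X j i = v i j 0 / Num.sqrt (d j).
  by rewrite mxE mul_diag_mx !mxE mulrC.
have dev_out j : j \notin P -> deviation d P A j 0 = 0.
  move=> jP; rewrite !mxE (negPf jP).
  case jA: (j \in A); first by rewrite (fintype.subsetP AP _ jA) in jP.
  by rewrite !mul0r mulr0 subr0.
have dev_sum : \sum_(j in P) deviation d P A j 0 * Num.sqrt (d j) = 0.
  transitivity (dotv (deviation d P A) (sqrt_indicator d P)).
    rewrite dotvE [LHS]big_mkcond; apply: eq_bigr => j _.
    case: ifPn => jP; first by rewrite [sqrt_indicator _ _ _ _]mxE jP mul1r.
    by rewrite dev_out // mul0r.
  rewrite dotvBl dotvZl.
  by rewrite !dotv_sqrt_indicator // divfK ?subrr // gt_eqF.
(* [v i] is the square root of [d] times column [i] of [X]; the term added for [r] is a multiple of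
   [dev_sum], which is 0. *)
have dotE (i : 'I_k) : dotv (deviation d P A) (v i)
    = \sum_(j in P) deviation d P A j 0 * (Num.sqrt (d j) * (X j i - r 0 i)).
  transitivity (\sum_(j in P) deviation d P A j 0 * v i j 0
    - r 0 i * \sum_(j in P) deviation d P A j 0 * Num.sqrt (d j)).
    rewrite dev_sum mulr0 subr0 dotvE [RHS]big_mkcond; apply: eq_bigr => j _.
    by case: ifPn => // jP; rewrite dev_out // mul0r.
  rewrite mulr_sumr -sumrB; apply: eq_bigr => j _; rewrite XE.
  by field.
(* Cauchy-Schwarz in each of the k coordinates separately; exchanging the sums then assembles the
   squared distances to [r]. *)
apply: (@le_trans _ _ (\sum_(i < k) vol d P
    * \sum_(j in P) d j * (X j i - r 0 i) ^+ 2)).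
  apply: ler_sum => i _; rewrite dotE; apply: (le_trans (sqr_sum_mul_le _ _ _)).
  apply: ler_pM.
  - by apply: sumr_ge0 => j _; exact: sqr_ge0.
  - by apply: sumr_ge0 => j _; exact: sqr_ge0.
  - apply: le_trans (dotv_deviation_le d0 P0 AP); rewrite dotvE.
    rewrite [leRHS](bigID (mem P)) /= -[leLHS]addr0; apply: lerD.
      by apply: ler_sum => j _; rewrite expr2.
    by apply: sumr_ge0 => j _; rewrite -expr2 sqr_ge0.
  - apply: ler_sum => j _; rewrite exprMn sqr_sqrtr //; exact: ltW.
rewrite -mulr_sumr exchange_big /= ler_wpM2l ?(ltW vP) //.
apply: ler_sum => j _; rewrite -mulr_sumr ler_wpM2l ?(ltW (d0 j)) //.
by apply: ler_sum => i _; rewrite !mxE.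
Qed.

Lemma cell_cost_le n k (d : 'I_n -> R) (X : 'M[R]_(n, k))
    (P : 'I_k -> {set 'I_n}) (a : 'I_k) :
  (forall i, 0 < d i) ->
  \sum_(j in P a) d j * sqnorm (row j X - wmean d X (P a))
    <= partition_cost d X P.
Proof.
move=> d0; rewrite /partition_cost [leRHS](bigD1 a) //= lerDl.
apply: sumr_ge0 => b _; apply: sumr_ge0 => j _; rewrite mulr_ge0 ?(ltW (d0 j)) //.
by apply: sumr_ge0 => i _; exact: sqr_ge0.
Qed.

(** The square roots in the weighted indicators cancel the normalization in [corr_mx]. *)
Lemma cut_corr_mx n m (C : 'M[R]_(n, m)) A B :
  (forall i, 0 < drow C i) -> (forall j, 0 < dcol C j) ->
  cut C A B = dotv (sqrt_indicator (drow C) A)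
                   (corr_mx C *m sqrt_indicator (dcol C) B).
Proof.
move=> dr0 dc0; rewrite dotvE /cut big_mkcond; apply: eq_bigr => i _.
rewrite [sqrt_indicator _ _ _ _]mxE; case: (i \in A); last by rewrite !mul0r.
rewrite mul1r mxE mulr_sumr big_mkcond; apply: eq_bigr => j _.
rewrite /corr_mx /diag_invsqrt mul_mx_diag mul_diag_mx !mxE.
have si : Num.sqrt (drow C i) != 0 by rewrite gt_eqF // sqrtr_gt0.
have sj : Num.sqrt (dcol C j) != 0 by rewrite gt_eqF // sqrtr_gt0.
case: (j \in B); last by rewrite !mul0r !mulr0.
by rewrite /=; field; rewrite si sj.
Qed.

Lemma drow_gt0 n m (C : 'M[R]_(n, m)) :
  contingency_table C -> forall i, 0 < drow C i.
Proof.
case=> C0 rowC _ i; have [j Cij] := rowC i.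
rewrite /drow (bigD1 j) //= ltr_pwDl ?lt_def ?Cij ?C0 //.
by apply: sumr_ge0.
Qed.

Lemma dcol_gt0 n m (C : 'M[R]_(n, m)) :
  contingency_table C -> forall j, 0 < dcol C j.
Proof.
case=> C0 _ colC j; have [i Cij] := colC j.
rewrite /dcol (bigD1 i) //= ltr_pwDl ?lt_def ?Cij ?C0 //.
by apply: sumr_ge0.
Qed.

End Clusters.

(** * The discrepancy bound for a pair of clusters *)

Theorem theorem8 (R : realType) (k : nat)
    (K1 K2 alpha1 beta1 alpha2 beta2 : R)
    (hk : (1 <= k)%N)
    (hK1 : 0 < K1 /\ K1 <= k%:R^-1)
    (hK2 : 0 < K2 /\ K2 <= k%:R^-1)
    (hab1 : 0 < alpha1 /\ alpha1 <= beta1)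
    (hab2 : 0 < alpha2 /\ alpha2 <= beta2) :
  exists L : R, 0 < L /\
    forall (n m : nat) (C : 'M[R]_(n, m)) (eps : R)
           (s : nat -> R) (v : nat -> 'cV[R]_n) (u : nat -> 'cV[R]_m)
           (P : 'I_k -> {set 'I_n}) (Q : 'I_k -> {set 'I_m}),
      let X := representatives k (drow C) v in
      let Y := representatives k (dcol C) u in
      contingency_table C ->
      non_decomposable C ->
      \sum_(i < n) \sum_(j < m) C i j = 1 ->
      (forall i, alpha1 / n%:R <= drow C i /\ drow C i <= beta1 / n%:R) ->
      (forall j, alpha2 / m%:R <= dcol C j /\ dcol C j <= beta2 / m%:R) ->
      0 <= eps ->
      is_svd (corr_mx C) s v u ->
      s 0%N = 1 ->
      ((1 < k)%N -> s 1%N < s 0%N) ->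
      eps < s k.-1 ->
      (forall i, (k <= i)%N -> s i <= eps) ->
      optimal_partition (drow C) X P ->
      optimal_partition (dcol C) Y Q ->
      (forall a, K1 * n%:R <= #|P a|%:R) ->
      (forall b, K2 * m%:R <= #|Q b|%:R) ->
      forall a b : 'I_k,
        volume_regular C
          (L * (Num.sqrt (2 * k%:R)
                  * (Num.sqrt (kvariance (drow C) X)
                       + Num.sqrt (kvariance (dcol C) Y))
                + eps))
          (P a) (Q b).
Proof.
(* Each of the two terms of the discrepancy contributes one [eps]. *)
exists 2; split; first by rewrite ltr0n.
move=> n m C eps s v u P Q X Y ct _ _ _ _ eps0 svdC s0 _ sk tail.
move=> [Ppart PX] [Qpart QY] _ _ a b A B AP BQ.
have [d0 e0] := (drow_gt0 ct, dcol_gt0 ct).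
have [P0 _ _] := Ppart; have [Q0 _ _] := Qpart.
(* If the rank were below k, then [s k.-1] would be 0, against 0 <= [eps] < [s k.-1]. *)
have kr : (k <= \rank (corr_mx C))%N.
  rewrite leqNgt; apply/negP => rk; have [[_ s_eq0] _ _ _ _] := svdC.
  have : s k.-1 = 0 by apply: s_eq0; rewrite -ltnS prednK.
  by move=> sk0; move: sk; rewrite sk0 ltNge eps0.
have [_ _ ov ou _] := svdC.
have {ov} ov := orthonormal_uptoW kr ov; have {ou} ou := orthonormal_uptoW kr ou.
set d := drow C in d0 X PX *; set e := dcol C in e0 Y QY *.
have vP := vol_gt0 d0 (P0 a); have vQ := vol_gt0 e0 (Q0 b).
(* With [r] the weighted mean of the cluster, the bound is one cell of the partition cost, and
   optimality makes the total cost the k-variance. *)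
have head_P : \sum_(i < k) dotv (deviation d (P a) A) (v i) ^+ 2
    <= vol d (P a) * kvariance d X.
  have := deviation_representatives_le v (wmean d X (P a)) d0 (P0 a) AP.
  move/le_trans; apply.
  by rewrite -PX ler_wpM2l ?(ltW vP) ?cell_cost_le.
have head_Q : \sum_(i < k) dotv (deviation e (Q b) B) (u i) ^+ 2
    <= vol e (Q b) * kvariance e Y.
  have := deviation_representatives_le u (wmean e Y (Q b)) e0 (Q0 b) BQ.
  move/le_trans; apply.
  by rewrite -QY ler_wpM2l ?(ltW vQ) ?cell_cost_le.
pose tA := vol d A / vol d (P a).
(* The mixed terms [t_A w_P^T C_corr w_B] cancel between the two summands. *)
have -> : cut C A B - density C (P a) (Q b) * vol d A * vol e B
  = dotv (deviation d (P a) A) (corr_mx C *m sqrt_indicator e B)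
    + dotv (tA *: sqrt_indicator d (P a)) (corr_mx C *m deviation e (Q b) B).
  rewrite /density !cut_corr_mx // -/d -/e /deviation mulmxBr -scalemxAr.
  rewrite dotvBl dotvBr dotvZr !dotvZl /tA.
  by field; rewrite !gt_eqF.
have norm_P : dotv (tA *: sqrt_indicator d (P a)) (tA *: sqrt_indicator d (P a))
    <= vol d (P a).
  rewrite dotvZl dotvZr dotv_sqrt_indicator // mulrA -expr2.
  rewrite ler_piMl ?(ltW vP) // expr_le1 // ?divr_ge0 ?vol_ge0 //.
  by rewrite ler_pdivrMr // mul1r vol_subset.
have norm_Q : dotv (sqrt_indicator e B) (sqrt_indicator e B) <= vol e (Q b).
  by rewrite dotv_sqrt_indicator ?vol_subset.
have s01 : s 0%N <= 1 by rewrite s0.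
set N := Num.sqrt (vol d (P a) * vol e (Q b)).
set SX := Num.sqrt (kvariance d X); set SY := Num.sqrt (kvariance e Y).
have NE : N = Num.sqrt (vol d (P a)) * Num.sqrt (vol e (Q b)).
  by rewrite /N sqrtrM // ltW.
have N0 : 0 <= N by rewrite sqrtr_ge0.
(* Only the left argument is a residual: its head brings [SX], while the head of [w_B] is at most
   its full norm. *)
have bound1 : `|dotv (deviation d (P a) A) (corr_mx C *m sqrt_indicator e B)|
    <= (SX + eps) * N.
  apply: (le_trans (svd_bilinear_le _ _ svdC s01 kr eps0 tail)).
  have -> : (SX + eps) * N
      = (Num.sqrt (vol d (P a)) * SX) * Num.sqrt (vol e (Q b)) + eps * N.
    by rewrite NE; ring.
  rewrite NE lerD // ?ler_wpM2l // ler_pM ?sqrtr_ge0 //.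
  - by rewrite -sqrtrM ?(ltW vP) // ler_wsqrtr.
  - by rewrite ler_wsqrtr // (le_trans (bessel _ ou)).
  - by rewrite ler_wsqrtr // dotv_deviation_le.
  - by rewrite ler_wsqrtr.
have bound2 : `|dotv (tA *: sqrt_indicator d (P a))
                     (corr_mx C *m deviation e (Q b) B)|
    <= (SY + eps) * N.
  apply: (le_trans (svd_bilinear_le _ _ svdC s01 kr eps0 tail)).
  have -> : (SY + eps) * N
      = Num.sqrt (vol d (P a)) * (Num.sqrt (vol e (Q b)) * SY) + eps * N.
    by rewrite NE; ring.
  rewrite NE lerD // ?ler_wpM2l // ler_pM ?sqrtr_ge0 //.
  - by rewrite ler_wsqrtr // (le_trans (bessel _ ov)).
  - by rewrite -sqrtrM ?(ltW vQ) // ler_wsqrtr.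
  - by rewrite ler_wsqrtr.
  - by rewrite ler_wsqrtr // dotv_deviation_le.
apply: (le_trans (ler_normD _ _)); apply: (le_trans (lerD bound1 bound2)).
rewrite -mulrDl ler_wpM2r //.
(* The estimates add up to [SX + SY + 2 * eps]; a factor of at least 1 on [SX + SY] gives the stated
   shape. *)
have k1 : 1 <= Num.sqrt (2 * k%:R) :> R.
  by rewrite -[leLHS]sqrtr1 ler_wsqrtr // -natrM ler1n muln_gt0.
have SX0 : 0 <= SX by rewrite sqrtr_ge0.
have SY0 : 0 <= SY by rewrite sqrtr_ge0.
by have := ler_wpM2r (addr_ge0 SX0 SY0) k1; lra.
Qed.
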